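(* Let $p\in\{0\}\cup[1,\infty)$. (1) Let $A=(a_{j,k})$ be a Köthe matrix on $\mathbb{Z}$, let $w=(w_j)_{j\in\mathbb{Z}}$ be a sequence of nonzero scalars, and suppose that the bilateral weighted forward shift $F_w((x_j)_{j\in\mathbb{Z}})=(w_{j-1}x_{j-1})_{j\in\mathbb{Z}}$ is an operator on $\lambda_p(A,\mathbb{Z})$. Then $F_w$ is uniformly positively expansive if and only if for each $k\in\mathbb{N}$ there exists $\ell\in\mathbb{N}$ such that $$\lim_{n\to\infty}\Big(\inf_{j\in I_k}\frac{a_{j+n,\ell}\,|w_j\cdots w_{j+n-1}|}{a_{j,k}}\Big)=\infty,\qquad\text{where } I_k=\{j\in\mathbb{Z}:a_{j,k}\ne0\}.$$ (2) Let $A=(a_{j,k})$ be a Köthe matrix on $\mathbb{N}$, let $w=(w_j)_{j\in\mathbb{N}}$ be a sequence of nonzero scalars, and suppose that the unilateral weighted forward shift $F_w(x_1,x_2,x_3,\ldots)=(0,w_1x_1,w_2x_2,\ldots)$ is an operator on $\lambda_p(A,\mathbb{N})$. Then $F_w$ is uniformly positively expansive if and only if for each $k\in\mathbb{N}$ there exists $\ell\in\mathbb{N}$ such that $$\lim_{n\to\infty}\Big(\inf_{j\in I_k}\frac{a_{j+n,\ell}\,|w_j\cdots w_{j+n-1}|}{a_{j,k}}\Big)=\infty,\qquad\text{where } I_k=\{j\in\mathbb{N}:a_{j,k}\ne0\}.$$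
   Context: $\mathbb{K}$ denotes $\mathbb{R}$ or $\mathbb{C}$, and $\mathbb{N}=\{1,2,3,\dots\}$. The infimum of a family indexed by the empty set is $\infty$. An operator on a locally convex space $X$ is a continuous linear map $X\to X$. Let $J=\mathbb{N}$ or $\mathbb{Z}$. A Köthe matrix on $J$ is a family of scalars $A=(a_{j,k})_{j\in J,k\in\mathbb{N}}$ such that for each $j\in J$: $0\le a_{j,1}\le a_{j,2}\le\cdots$, and $a_{j,k}>0$ for some $k$. For $p\in[1,\infty)$, $\lambda_p(A,J)=\{(x_j)\in\mathbb{K}^{J}:\sum_{j\in J}|a_{j,k}x_j|^p<\infty\text{ for all }k\}$ with seminorms $\|x\|_k=(\sum_{j\in J}|a_{j,k}x_j|^p)^{1/p}$. For $p=0$, $\lambda_0(A,J)=\{(x_j)\in\mathbb{K}^{J}:\lim_{j\in J,|j|\to\infty}a_{j,k}x_j=0\text{ for all }k\}$ with seminorms $\|x\|_k=\sup_{j\in J}|a_{j,k}x_j|$. The space carries the Fréchet topology induced by the increasing sequence $(\|\cdot\|_k)_{k\in\mathbb{N}}$. Uniform positive expansivity, expressed with the seminorms $(\|\cdot\|_k)_{k\in\mathbb{N}}$: an operator $T$ is uniformly positively expansive if for each $k\in\mathbb{N}$ there exists $\ell\in\mathbb{N}$ such that $\|T^nx\|_\ell\to\infty$ uniformly on $\{x\in X:\|x\|_k=1\}$ as $n\to\infty$. *)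

(* Defs.v *)
From HB Require Import structures.
From mathcomp Require Import all_boot all_order all_algebra.
From mathcomp Require Import all_classical all_reals all_analysis.
From mathcomp Require Import complex ring.

Set Implicit Arguments.
Unset Strict Implicit.
Unset Printing Implicit Defensive.

Import Order.TTheory GRing.Theory Num.Theory.
Import numFieldNormedType.Exports.

Local Open Scope classical_set_scope.
Local Open Scope ring_scope.

Variant scalar_field := RealScalars | ComplexScalars.

Definition scalars (R : realType) (F : scalar_field) : numFieldType :=
  match F with RealScalars => R | ComplexScalars => R[i] end.

Definition modulus (R : realType) (F : scalar_field) : scalars R F -> R :=
  match F with
  | RealScalars => fun c : R => `|c|
  | ComplexScalars => fun c : R[i] => Normc.normc c
  end.

Section modulus_theory.
Variables (R : realType) (F : scalar_field).
Implicit Types c d : scalars R F.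

Lemma modulus_ge0 c : 0 <= modulus c.
Proof.
by case: F c => [c|[a b]] /=; [exact: normr_ge0|exact: sqrtr_ge0].
Qed.

Lemma modulus0 : modulus (0 : scalars R F) = 0.
Proof. by case: F => /=; [exact: normr0|exact: Normc.normc0]. Qed.

Lemma modulusM c d : modulus (c * d) = modulus c * modulus d.
Proof. by case: F c d => c d /=; [exact: normrM|exact: Normc.normcM]. Qed.

Lemma le_modulusD c d : modulus (c + d) <= modulus c + modulus d.
Proof. by case: F c d => c d /=; [exact: ler_normD|exact: le_normcD]. Qed.

Lemma modulus_near (c : (scalars R F)^o) (e : R) : 0 < e ->
  \forall d \near c, modulus (d - c) < e.
Proof.
case: F c => c e0 /=.
  by apply/nbhs_ballP; exists e => //= d; rewrite /ball/= distrC.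
apply/nbhs_ballP; exists (e%:C)%C => /=; first by rewrite ltcR.
by move=> d; rewrite /ball/= distrC -[X in X < _]/((Normc.normc (d - c))%:C)%C ltcR.
Qed.

Lemma modulus_onem c : 0 <= c <= 1 -> modulus c + modulus (1 - c) = 1.
Proof.
case: F c => [c|[a b]] /=.
  by move=> /andP[c0 c1]; rewrite !ger0_norm ?subr_ge0// subrKC.
rewrite !lecE/= => /andP[/andP[/eqP -> a0] /andP[_ a1]].
rewrite subr0 expr0n/= !addr0 !sqrtr_sqr !ger0_norm ?subr_ge0// subrKC//.
Qed.

End modulus_theory.

Variant index_set := Naturals | Integers.

(* [Naturals] enumerates {1, 2, 3, ...} from 0. *)
Definition index (J : index_set) : choiceType :=
  match J with Naturals => nat | Integers => int end.

Definition index_abs (J : index_set) : index J -> nat :=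
  match J with Naturals => id | Integers => absz end.

(* The filter of the limits |j| -> oo. *)
Definition index_infty (J : index_set) : set_system (index J) :=
  filter_from setT (fun N : nat => [set j | (N <= index_abs j)%N]).

Lemma finite_index_ball (J : index_set) (N : nat) :
  finite_set [set j : index J | (index_abs j < N)%N].
Proof.
case: J => /=; first exact: finite_II.
apply: (@sub_finite_set _ _
  ([set Posz n | n in `I_N] `|` [set (- (Posz n)) | n in `I_N])).
  by case=> n /= nN; [left; exists n|right; exists n.+1; rewrite ?NegzE].
by rewrite finite_setU; split; apply: finite_image; exact: finite_II.
Qed.

#[global] Instance index_infty_filter (J : index_set) : Filter (@index_infty J).
Proof.
apply: filter_from_filter; first by exists 0%N.
move=> M N _ _; exists (maxn M N) => // j /=.
by rewrite geq_max => /andP.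
Qed.

(* The exponent: the value 0 stands for the c_0-type space. *)
Record exponent (R : realType) := Exponent {
  exponent_val :> R;
  exponentP : (exponent_val == 0) || (1 <= exponent_val) }.

(* The index k = 1, 2, 3, ... of the seminorms is enumerated from 0. *)
Record kothe_matrix (R : realType) (J : index_set) := KotheMatrix {
  kothe_coef :> index J -> nat -> R;
  kothe_ge0 : forall j, 0 <= kothe_coef j 0;
  kothe_incr : forall j k, kothe_coef j k <= kothe_coef j k.+1;
  kothe_pos : forall j, exists k, 0 < kothe_coef j k }.

Lemma le_kothe_coef (R : realType) (J : index_set) (A : kothe_matrix R J) j :
  {homo A j : k l / (k <= l)%N >-> k <= l}.
Proof. by apply: homo_leq => //; [exact: le_trans|exact: kothe_incr]. Qed.

Lemma kothe_coef_ge0 (R : realType) (J : index_set) (A : kothe_matrix R J) j k :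
  0 <= A j k.
Proof. by rewrite (le_trans (kothe_ge0 A j))// le_kothe_coef. Qed.

Section minkowski_esum.
Context (R : realType) (T : choiceType).
Implicit Types (p : R) (u v : T -> R).

Lemma esumZl_le (c : R) (f : T -> \bar R) : 0 <= c -> (forall t, 0 <= f t)%E ->
  (\esum_(t in [set: T]) (c%:E * f t) <= c%:E * \esum_(t in [set: T]) f t)%E.
Proof.
move=> c0 f0; apply: ge_ereal_sup => _ [X finX <-].
rewrite -ge0_mule_fsumr//; apply: lee_wpmul2l; first by rewrite lee_fin.
by apply: esum_ge; exists X.
Qed.

Lemma esum_powRD p (s t : R) u v : 1 <= p -> 0 < s -> 0 < t ->
  (forall j, 0 <= u j) -> (forall j, 0 <= v j) ->
  (\esum_(j in [set: T]) (u j `^ p)%:E <= (s `^ p)%:E)%E ->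
  (\esum_(j in [set: T]) (v j `^ p)%:E <= (t `^ p)%:E)%E ->
  (\esum_(j in [set: T]) ((u j + v j) `^ p)%:E <= ((s + t) `^ p)%:E)%E.
Proof.
move=> p1 s0 t0 u0 v0 us vt.
have st0 : 0 < s + t by rewrite addr_gt0.
have l01 : 0 <= s / (s + t) <= 1.
  apply/andP; split; first by rewrite divr_ge0// ltW.
  by rewrite ler_pdivrMr// mul1r lerDl ltW.
have lE : 1 - s / (s + t) = t / (s + t).
  by rewrite -[1](@divff _ (s + t)) ?gt_eqF// -mulrBl addrAC subrr add0r.
pose cs := (s + t) `^ p * (s / (s + t)) / s `^ p.
pose ct := (s + t) `^ p * (t / (s + t)) / t `^ p.
have cs0 : 0 <= cs by rewrite !(mulr_ge0,invr_ge0,powR_ge0)// ltW.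
have ct0 : 0 <= ct by rewrite !(mulr_ge0,invr_ge0,powR_ge0)// ltW.
have le_uv j : (u j + v j) `^ p <= cs * u j `^ p + ct * v j `^ p.
  have us0 : 0 <= u j / s by rewrite divr_ge0// ltW.
  have vt0 : 0 <= v j / t by rewrite divr_ge0// ltW.
  have cvx : (s / (s + t) * (u j / s) + t / (s + t) * (v j / t)) `^ p <=
      s / (s + t) * (u j / s) `^ p + t / (s + t) * (v j / t) `^ p.
    have := @convex_powR R p p1
      (Itv01 (proj1 (andP l01)) (proj2 (andP l01))) (u j / s) (v j / t).
    rewrite !inE/= !in_itv/= us0 vt0 -lE => /(_ isT isT).
    by rewrite !convRE.
  have -> : u j + v j =
      (s + t) * (s / (s + t) * (u j / s) + t / (s + t) * (v j / t)).
    by field; rewrite !gt_eqF.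
  rewrite powRM ?(ltW st0)//; last first.
    by rewrite addr_ge0// mulr_ge0// divr_ge0// ltW.
  apply: (le_trans (ler_wpM2l (powR_ge0 _ _) cvx)).
  rewrite !powRM ?invr_ge0 ?(ltW s0) ?(ltW t0)//.
  have powRV (x : R) : 0 < x -> x^-1 `^ p = (x `^ p)^-1.
    by move=> x0; rewrite -powR_inv1 ?(ltW x0)// powRAC powR_inv1 ?powR_ge0.
  rewrite !powRV// /cs /ct mulrDr le_eqVlt; apply/orP; left.
  by apply/eqP; ring.
apply: le_trans (le_esum (b := fun j => (cs%:E * (u j `^ p)%:E + ct%:E * (v j `^ p)%:E)%E) _) _.
  by move=> j _; rewrite -!EFinM -EFinD lee_fin.
rewrite esumD; last 2 first.
- by move=> j _; rewrite -EFinM lee_fin mulr_ge0// powR_ge0.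
- by move=> j _; rewrite -EFinM lee_fin mulr_ge0// powR_ge0.
apply: (@le_trans _ _ (cs%:E * (s `^ p)%:E + ct%:E * (t `^ p)%:E)%E).
  apply: leeD; (apply: le_trans; first apply: esumZl_le) => //.
  - by move=> j; rewrite lee_fin powR_ge0.
  - by apply: lee_wpmul2l => //; rewrite lee_fin.
  - by move=> j; rewrite lee_fin powR_ge0.
  - by apply: lee_wpmul2l => //; rewrite lee_fin.
rewrite -!EFinM -EFinD lee_fin /cs /ct !divfK ?gt_eqF ?powR_gt0//.
by rewrite -mulrDr -mulrDl divff ?mulr1// gt_eqF.
Qed.

End minkowski_esum.

Section kothe_space.
Context (R : realType) (F : scalar_field) (J : index_set).
Variables (p : exponent R) (A : kothe_matrix R J).
Local Notation K := (scalars R F).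
Implicit Types x y : index J -> K^o.

(* As [A j k >= 0], this is |a_{j,k} x_j|. *)
Definition kothe_term x (k : nat) (j : index J) : R := A j k * modulus (x j).

Definition in_kothe x : Prop :=
  forall k,
    if p == 0 :> R then kothe_term x k j @[j --> @index_infty J] --> (0 : R)
    else (\esum_(j in [set: index J]) (kothe_term x k j `^ p)%:E < +oo)%E.

End kothe_space.

HB.lock Definition kothe_seminorm (R : realType) (F : scalar_field)
    (J : index_set) (p : exponent R) (A : kothe_matrix R J) (k : nat)
    (x : index J -> (scalars R F)^o) : R :=
  if p == 0 :> R then sup (range (kothe_term A x k))
  else fine (\esum_(j in [set: index J]) (kothe_term A x k j `^ p)%:E)
       `^ (p : R)^-1.

Section kothe_space_theory.
Context (R : realType) (F : scalar_field) (J : index_set).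
Variables (p : exponent R) (A : kothe_matrix R J).
Local Notation K := (scalars R F).
Local Notation kothe_term := (@kothe_term R F J A).
Local Notation in_kothe := (@in_kothe R F J p A).
Local Notation kothe_seminorm := (@kothe_seminorm R F J p A).
Implicit Types x y : index J -> K^o.

Lemma kothe_term_ge0 x k j : 0 <= kothe_term x k j.
Proof. by rewrite mulr_ge0 ?kothe_coef_ge0 ?modulus_ge0. Qed.

Lemma le_kothe_termD x y k j :
  kothe_term (x + y) k j <= kothe_term x k j + kothe_term y k j.
Proof. by rewrite -mulrDr ler_wpM2l ?kothe_coef_ge0// le_modulusD. Qed.

Lemma kothe_termZ (c : K) x k j :
  kothe_term (c *: x) k j = modulus c * kothe_term x k j.
Proof. by rewrite /Defs.kothe_term modulusM mulrCA. Qed.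

Lemma kothe_term0 k j : kothe_term 0 k j = 0.
Proof. by rewrite /Defs.kothe_term modulus0 mulr0. Qed.

Lemma le_kothe_term x k l j : (k <= l)%N -> kothe_term x k j <= kothe_term x l j.
Proof. by move=> kl; rewrite ler_wpM2r ?modulus_ge0// le_kothe_coef. Qed.

Lemma exponent_ge1 : p != 0 :> R -> 1 <= (p : R).
Proof. by move=> p0; have := exponentP p; rewrite (negbTE p0). Qed.

Lemma exponent_gt0 : p != 0 :> R -> 0 < (p : R).
Proof. by move=> /exponent_ge1; exact: lt_le_trans. Qed.

Local Notation psum x k :=
  (\esum_(j in [set: index J]) (kothe_term x k j `^ p)%:E)%E.

Lemma psum_ge0 x k : (0 <= psum x k)%E.
Proof. by apply: esum_ge0 => j _; rewrite lee_fin powR_ge0. Qed.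

Lemma psumE x k : in_kothe x -> p != 0 :> R ->
  psum x k = (kothe_seminorm k x `^ p)%:E.
Proof.
move=> xA p0; have := xA k; rewrite unlock (negbTE p0) => fin.
rewrite -powRrM mulVf// powRr1 ?fine_ge0 ?psum_ge0// fineK//.
by rewrite ge0_fin_numE// psum_ge0.
Qed.

Lemma kothe_has_ubound x k : in_kothe x -> p == 0 :> R ->
  has_ubound (range (kothe_term x k)).
Proof.
move=> xA p0; have := xA k; rewrite p0 => /cvgrPdist_lt/(_ 1 ltr01)[N _ HN].
have [M HM] : exists M : R, forall j, (index_abs j < N)%N -> kothe_term x k j <= M.
  have fin := finite_image (kothe_term x k) (finite_index_ball J N).
  have [s sE] := iffLR (finite_seqP _) fin.
  exists (\sum_(z <- s) `|z|) => j jN.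
  have : [set` s] (kothe_term x k j) by rewrite -sE; exists j.
  move=> /= js; rewrite (big_rem (kothe_term x k j))//=.
  by rewrite (le_trans (ler_norm _))// lerDl sumr_ge0.
exists (Num.max M 1) => _ [j _ <-]; rewrite le_max.
have [/HM->//|/HN/=] := ltnP (index_abs j) N.
by rewrite sub0r normrN => /ltW /(le_trans (ler_norm _)) ->; rewrite orbT.
Qed.

Lemma kothe_term_le x k j : in_kothe x -> p == 0 :> R ->
  kothe_term x k j <= kothe_seminorm k x.
Proof.
move=> xA p0; rewrite unlock p0; apply: ub_le_sup; last by exists j.
exact: kothe_has_ubound.
Qed.

Lemma index_inhabited : index J.
Proof. by case: J => /=; exact: 0. Qed.

Lemma kothe_seminorm_ge0 k x : in_kothe x -> 0 <= kothe_seminorm k x.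
Proof.
move=> xA; have [p0|p0] := boolP (p == 0 :> R).
  by rewrite (le_trans _ (kothe_term_le k index_inhabited xA p0))// kothe_term_ge0.
by rewrite unlock (negbTE p0) powR_ge0.
Qed.

Lemma kothe_seminorm_le k x (M : R) : 0 <= M ->
  (p == 0 :> R -> forall j, kothe_term x k j <= M) ->
  (p != 0 :> R -> (psum x k <= (M `^ p)%:E)%E) ->
  kothe_seminorm k x <= M.
Proof.
move=> M0 sup_le sum_le; rewrite unlock.
have [p0|p0] := boolP (p == 0 :> R).
  apply: ge_sup; first by exists (kothe_term x k index_inhabited), index_inhabited.
  by move=> _ [j _ <-]; exact: sup_le.
have p_gt0 := exponent_gt0 p0.
have {}sum_le := sum_le p0.
have -> : M = (M `^ p) `^ (p : R)^-1 by rewrite -powRrM divff// powRr1.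
apply: ge0_ler_powR; rewrite ?nnegrE ?invr_ge0 ?(ltW p_gt0) ?powR_ge0//.
  by rewrite fine_ge0// psum_ge0.
rewrite -lee_fin fineK// ge0_fin_numE ?psum_ge0//.
by rewrite (le_lt_trans sum_le)// ltry.
Qed.

Lemma in_kothe0 : in_kothe 0.
Proof.
move=> k; case: ifPn => p0.
  by under eq_fun do rewrite kothe_term0; exact: cvg_cst.
rewrite esum1 ?ltry// => j _.
by rewrite kothe_term0 powR0.
Qed.

Lemma psumD_le x y k : in_kothe x -> in_kothe y -> p != 0 :> R ->
  forall e : R, 0 < e ->
  (psum (x + y) k <=
   ((kothe_seminorm k x + e + (kothe_seminorm k y + e)) `^ p)%:E)%E.
Proof.
move=> xA yA p0 e e0.
have p1 := exponent_ge1 p0; have pge0 := ltW (exponent_gt0 p0).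
have x0 := kothe_seminorm_ge0 k xA; have y0 := kothe_seminorm_ge0 k yA.
have xe0 : 0 < kothe_seminorm k x + e := ltr_wpDl x0 e0.
have ye0 : 0 < kothe_seminorm k y + e := ltr_wpDl y0 e0.
have psum_le z : in_kothe z -> 0 <= kothe_seminorm k z ->
    (psum z k <= ((kothe_seminorm k z + e) `^ p)%:E)%E.
  move=> zA z0; rewrite psumE// lee_fin.
  by apply: ge0_ler_powR; rewrite ?nnegrE ?addr_ge0 ?lerDl ?(ltW e0).
have := esum_powRD p1 xe0 ye0 (kothe_term_ge0 x k) (kothe_term_ge0 y k)
  (psum_le x xA x0) (psum_le y yA y0).
apply: le_trans; apply: le_esum => j _.
rewrite lee_fin; apply: ge0_ler_powR => //; rewrite ?nnegrE.
- exact: kothe_term_ge0.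
- by rewrite addr_ge0 ?kothe_term_ge0.
- exact: le_kothe_termD.
Qed.

Lemma in_kotheD x y : in_kothe x -> in_kothe y -> in_kothe (x + y).
Proof.
move=> xA yA k; case: ifPn => p0; last first.
  by rewrite (le_lt_trans (psumD_le k xA yA p0 ltr01))// ltry.
have := xA k; have := yA k; rewrite p0 => yk xk.
have xyk : kothe_term x k j + kothe_term y k j @[j --> @index_infty J] --> (0 : R).
  by rewrite -[0]addr0; exact: cvgD.
apply: (squeeze_cvgr _ (cvg_cst 0) xyk).
by apply: nearW => j; rewrite kothe_term_ge0 le_kothe_termD.
Qed.

Lemma psumZ_le (c : K) x k : p != 0 :> R ->
  (psum (c *: x) k <= (modulus c `^ p)%:E * psum x k)%E.
Proof.
move=> p0.
apply: le_trans (esumZl_le (powR_ge0 _ _) _).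
  apply: le_esum => j _; rewrite kothe_termZ -EFinM lee_fin.
  by rewrite powRM ?modulus_ge0 ?kothe_term_ge0.
by move=> j; rewrite lee_fin powR_ge0.
Qed.

Lemma in_kotheZ (c : K) x : in_kothe x -> in_kothe (c *: x).
Proof.
move=> xA k; case: ifPn => p0; last first.
  rewrite (le_lt_trans (psumZ_le c x k p0))// psumE//.
  by rewrite -EFinM ltry.
have := xA k; rewrite p0 => xk.
under eq_fun do rewrite kothe_termZ.
by rewrite -(mulr0 (modulus c)); apply: cvgM => //; exact: cvg_cst.
Qed.

Lemma kothe_seminormD k x y : in_kothe x -> in_kothe y ->
  kothe_seminorm k (x + y) <= kothe_seminorm k x + kothe_seminorm k y.
Proof.
move=> xA yA; apply/ler_addgt0Pr => e e0.
have x0 := kothe_seminorm_ge0 k xA; have y0 := kothe_seminorm_ge0 k yA.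
have e20 : 0 < e / 2 by rewrite divr_gt0.
apply: kothe_seminorm_le; first by rewrite !addr_ge0// ltW.
  move=> p0 j; rewrite (le_trans (le_kothe_termD _ _ _ _))//.
  by rewrite (le_trans (lerD (kothe_term_le k j xA p0) (kothe_term_le k j yA p0)))//
    lerDl ltW.
move=> p0; rewrite (le_trans (psumD_le k xA yA p0 e20))//.
by rewrite addrACA -splitr.
Qed.

Lemma kothe_seminormZ_le k (c : K) x : in_kothe x ->
  kothe_seminorm k (c *: x) <= modulus c * kothe_seminorm k x.
Proof.
move=> xA; have x0 := kothe_seminorm_ge0 k xA.
apply: kothe_seminorm_le; first by rewrite mulr_ge0// modulus_ge0.
  move=> p0 j; rewrite kothe_termZ ler_wpM2l ?modulus_ge0//.
  exact: kothe_term_le.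
move=> p0; rewrite (le_trans (psumZ_le _ _ _ p0))// psumE//.
by rewrite -EFinM -powRM ?modulus_ge0.
Qed.

Lemma kothe_seminorm0 k : kothe_seminorm k 0 = 0.
Proof.
apply/eqP; rewrite eq_le kothe_seminorm_ge0; last exact: in_kothe0.
rewrite andbT; have := kothe_seminormZ_le k 0 in_kothe0.
by rewrite scale0r modulus0 mul0r.
Qed.

Lemma le_kothe_seminorm x k l : in_kothe x -> (k <= l)%N ->
  kothe_seminorm k x <= kothe_seminorm l x.
Proof.
move=> xA kl; apply: kothe_seminorm_le; first exact: kothe_seminorm_ge0.
  move=> p0 j; rewrite (le_trans (le_kothe_term _ _ kl))//.
  exact: kothe_term_le.
move=> p0; rewrite -psumE//; apply: le_esum => j _.
rewrite lee_fin ge0_ler_powR ?nnegrE ?kothe_term_ge0 ?le_kothe_term//.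
exact/ltW/exponent_gt0.
Qed.

Definition kothe_mem : {pred index J -> K^o} := fun x => `[< in_kothe x >].

Lemma kothe_submod_closed : submod_closed kothe_mem.
Proof.
split; first exact/asboolP/in_kothe0.
move=> c x y /asboolP xA /asboolP yA; apply/asboolP.
by apply: in_kotheD => //; exact: in_kotheZ.
Qed.

HB.instance Definition _ := GRing.isSubmodClosed.Build _ _ kothe_mem
  kothe_submod_closed.

Record kothe := Kothe {
  kothe_val : index J -> K^o;
  kothe_valP : kothe_val \in kothe_mem }.

HB.instance Definition _ := [isSub for kothe_val].
HB.instance Definition _ := [Choice of kothe by <:].
HB.instance Definition _ := [SubChoice_isSubLmodule of kothe by <:].

End kothe_space_theory.

Section kothe_topology.
Context (R : realType) (F : scalar_field) (J : index_set).
Variables (p : exponent R) (A : kothe_matrix R J).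
Local Notation K := (scalars R F).
Local Notation E := (kothe F p A).
Implicit Types x y z : E.

Definition seminorm (k : nat) x : R := kothe_seminorm p A k (kothe_val x).

Lemma kothe_valW x : in_kothe p A (kothe_val x).
Proof. exact/asboolP/kothe_valP. Qed.

Lemma seminorm_ge0 k x : 0 <= seminorm k x.
Proof. exact/kothe_seminorm_ge0/kothe_valW. Qed.

Lemma seminorm0 k : seminorm k 0 = 0.
Proof. exact: kothe_seminorm0. Qed.

Lemma le_seminormD k x y : seminorm k (x + y) <= seminorm k x + seminorm k y.
Proof. by apply: kothe_seminormD; exact: kothe_valW. Qed.

Lemma seminormZ_le k (c : K) x : seminorm k (c *: x) <= modulus c * seminorm k x.
Proof. by apply: kothe_seminormZ_le; exact: kothe_valW. Qed.

Lemma le_seminorm k l x : (k <= l)%N -> seminorm k x <= seminorm l x.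
Proof. by apply: le_kothe_seminorm; exact: kothe_valW. Qed.

Definition kothe_ball x (k : nat) (e : R) : set E :=
  [set y | seminorm k (y - x) < e].

(* As the seminorms increase with k, the balls of all [seminorm k] form a base
   of neighbourhoods. *)
Definition kothe_nbhs x : set_system E :=
  [set U | exists k, exists2 e : R, 0 < e & kothe_ball x k e `<=` U].

HB.instance Definition _ := hasNbhs.Build E kothe_nbhs.

Lemma kothe_ball_triangle x y k (e e' : R) z :
  kothe_ball x k e y -> kothe_ball y k e' z -> kothe_ball x k (e + e') z.
Proof.
rewrite /kothe_ball/= => xy yz; rewrite -(subrKA y) addrC.
by rewrite (le_lt_trans (le_seminormD _ _ _))// ltrD// addrC.
Qed.

Let kothe_nbhs_filter x : ProperFilter (nbhs x).
Proof.
apply: Build_ProperFilter_ex.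
  move=> U [k [e e0 xU]]; exists x; apply: xU.
  by rewrite /kothe_ball/= subrr seminorm0.
split; first by exists 0%N, 1.
  move=> U V [k [e e0 xU]] [l [d d0 xV]].
  exists (maxn k l), (Num.min e d); first by rewrite lt_min e0.
  move=> y; rewrite /kothe_ball/= lt_min => /andP[ye yd]; split.
    by apply: xU; rewrite /kothe_ball/= (le_lt_trans _ ye)// le_seminorm// leq_maxl.
  by apply: xV; rewrite /kothe_ball/= (le_lt_trans _ yd)// le_seminorm// leq_maxr.
by move=> U V UV [k [e e0 xU]]; exists k, e => //; exact: subset_trans UV.
Qed.

Let kothe_nbhs_singleton x (U : set E) : nbhs x U -> U x.
Proof.
by move=> [k [e e0]]; apply; rewrite /kothe_ball/= subrr seminorm0.
Qed.

Let kothe_ball_nbhs x k e y : kothe_ball x k e y -> kothe_nbhs y (kothe_ball x k e).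
Proof.
move=> xy; exists k, (e - seminorm k (y - x)); first by rewrite subr_gt0.
move=> z yz; rewrite /kothe_ball/= -(subrKA y) (le_lt_trans (le_seminormD _ _ _))//.
by rewrite -ltrBrDr.
Qed.

Let kothe_nbhs_nbhs x (U : set E) : nbhs x U -> nbhs x (nbhs^~ U).
Proof.
move=> [k [e e0 xU]]; exists k, e => // y /kothe_ball_nbhs[l [d d0 yB]].
by exists l, d => //; exact: subset_trans yB xU.
Qed.

HB.instance Definition _ := Nbhs_isNbhsTopological.Build E
  kothe_nbhs_filter kothe_nbhs_singleton kothe_nbhs_nbhs.

Let near_ball x k (e : R) : 0 < e -> nbhs x (kothe_ball x k e).
Proof. by move=> e0; exists k, e. Qed.

Let kothe_add_continuous : continuous (fun xy : E * E => xy.1 + xy.2).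
Proof.
move=> [x y] U [k [e e0 xyU]].
have e20 : 0 < e / 2 by rewrite divr_gt0.
exists (kothe_ball x k (e / 2), kothe_ball y k (e / 2)).
  by split; exact: near_ball.
move=> [x' y'] [/= xx' yy']; apply: xyU.
rewrite /kothe_ball/= opprD addrACA (le_lt_trans (le_seminormD _ _ _))//.
by rewrite [e]splitr ltrD.
Qed.

Let kothe_scale_continuous : continuous (fun cx : K^o * E => cx.1 *: cx.2).
Proof.
move=> [c x] U [k [e e0 cxU]].
pose d1 := Num.min 1 (e / 2 / (seminorm k x + 1)).
pose d2 := e / 2 / (modulus c + 1).
have x1 : 0 < seminorm k x + 1 by rewrite ltr_wpDl// seminorm_ge0.
have c1 : 0 < modulus c + 1 by rewrite ltr_wpDl// modulus_ge0.
have d10 : 0 < d1 by rewrite lt_min ltr01 !divr_gt0.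
have d20 : 0 < d2 by rewrite !divr_gt0.
exists ([set c' : K^o | modulus (c' - c) < d1], kothe_ball x k d2).
  by split; [exact: modulus_near|exact: near_ball].
move=> [c' x'] [/= cc' xx']; apply: cxU; rewrite /kothe_ball/=.
have -> : c' *: x' - c *: x = c' *: (x' - x) + (c' - c) *: x.
  by rewrite scalerBr scalerBl addrA subrK.
rewrite (le_lt_trans (le_seminormD _ _ _))// [e]splitr.
have c'le : modulus c' <= modulus c + 1.
  rewrite -[in leLHS](subrK c c') (le_trans (le_modulusD _ _))// addrC lerD2l.
  by apply: ltW; apply: (lt_le_trans cc'); rewrite ge_min lexx.
apply: ltr_leD.
  rewrite (le_lt_trans (seminormZ_le _ _ _))//.
  apply: (@le_lt_trans _ _ ((modulus c + 1) * seminorm k (x' - x))).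
    by rewrite ler_wpM2r// seminorm_ge0.
  by rewrite mulrC -ltr_pdivlMr.
rewrite (le_trans (seminormZ_le _ _ _))//.
apply: (@le_trans _ _ (e / 2 / (seminorm k x + 1) * seminorm k x)).
  rewrite ler_wpM2r ?seminorm_ge0//.
  by apply: ltW; apply: (lt_le_trans cc'); rewrite ge_min lexx orbT.
rewrite -mulrA ler_piMr ?(ltW (divr_gt0 _ _))// mulrC.
by rewrite ler_pdivrMr// mul1r lerDl.
Qed.

Let kothe_ball_convex x k (e : R) : convex_set (kothe_ball x k e).
Proof.
move=> y z l /set_mem xy /set_mem xz; apply/mem_set.
pose c : K := l%:num.
have c01 : 0 <= c <= 1 by rewrite /c ge0 le1.
change (seminorm k (c *: (y : E) + (1 - c) *: (z : E) - x) < e).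
have -> : c *: (y : E) + (1 - c) *: (z : E) - x =
    c *: (y - x) + (1 - c) *: (z - x).
  rewrite !scalerBr addrACA -opprD -scalerDl.
  by rewrite [c + _]addrC subrK scale1r.
rewrite (le_lt_trans (le_seminormD _ _ _))//.
apply: (le_lt_trans (lerD (seminormZ_le _ _ _) (seminormZ_le _ _ _))).
have sumc := modulus_onem c01.
pose M := Num.max (seminorm k (y - x)) (seminorm k (z - x)).
have Me : M < e by rewrite gt_max; apply/andP.
apply: le_lt_trans Me; rewrite -[leRHS]mul1r -sumc mulrDl.
by apply: lerD; rewrite ler_wpM2l ?modulus_ge0// le_max lexx ?orbT.
Qed.

Let kothe_locally_convex :
  exists2 B : set_system E, (forall b, b \in B -> convex_set b) & basis B.
Proof.
exists [set kothe_ball i.1.1 i.1.2 i.2 | i in [set: E * nat * R]].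
  by move=> b /set_mem[i _ <-]; exact: kothe_ball_convex.
split.
  by move=> _ [i _ <-]; rewrite openE => y; exact: kothe_ball_nbhs.
move=> x U [k [e e0 xU]]; exists (kothe_ball x k e) => //=.
split; first by exists (x, k, e).
by rewrite /kothe_ball/= subrr seminorm0.
Qed.

(* The factory [PreTopologicalLmod_isTvs] only installs the uniform structure;
   the remaining mixins have to be declared separately. *)
HB.instance Definition _ := PreTopologicalLmod_isTvs.Build K E
  kothe_add_continuous kothe_scale_continuous kothe_locally_convex.
HB.instance Definition _ :=
  PreTopologicalNmodule_isTopologicalNmodule.Build E kothe_add_continuous.
HB.instance Definition _ :=
  TopologicalNmodule_isTopologicalLmodule.Build K E kothe_scale_continuous.
HB.instance Definition _ := Uniform_isTvs.Build K E kothe_locally_convex.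

End kothe_topology.

Arguments seminorm {R} F {J} p A k x.

Definition is_operator (K : numFieldType) (E : tvsType K) (T : E -> E) : Prop :=
  linear T /\ continuous T.

Definition uniformly_positively_expansive (R : realType) (K : numFieldType)
    (E : tvsType K) (sn : nat -> E -> R) (T : E -> E) : Prop :=
  forall k, exists l, forall M : R, \forall n \near \oo,
    forall x, sn k x = 1 -> M <= sn l (iter n T x).

Definition bilateral_forward_shift (K : numFieldType) (w x : int -> K) :
    int -> K := fun j => w (j - 1) * x (j - 1).

Definition unilateral_forward_shift (K : numFieldType) (w x : nat -> K) :
    nat -> K := fun j => if j is i.+1 then w i * x i else 0.

(* Main.v *)
Require Import Defs.
From mathcomp Require Import all_boot all_order all_algebra.
From mathcomp Require Import all_classical all_reals all_analysis.
From mathcomp Require Import complex.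

Set Implicit Arguments.
Unset Strict Implicit.
Unset Printing Implicit Defensive.

Import Order.TTheory GRing.Theory Num.Theory.
Import numFieldNormedType.Exports.

Local Open Scope classical_set_scope.
Local Open Scope ring_scope.

(** Both index sets are instances of one situation: [s] is an injective self-map
of the index set, [T] moves the coordinate at [j] to [s j] and multiplies it by
[w j], and the coordinates of [T x] off the range of [s] vanish. Then [T^n]
moves the coordinate at [j] to [s^n j] with the factor
[w j * w (s j) * ... * w (s^(n-1) j)], so the quotient
[q n j = a_(s^n j, l) |w j ... w (s^(n-1) j)| / a_(j, k)] is the ratio of the
term of [T^n x] at [s^n j] in the [l]-th seminorm to the term of [x] at [j] in
the [k]-th one.

If [q n j >= M] whenever [a_(j, k)] is nonzero, every term of [x], multiplied by
[M], is at most the term of [T^n x] at the shifted place. As [s^n] is injective,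
a supremum or an [l^p] sum can only grow, so [||T^n x||_l >= M ||x||_k]
([le_seminorm_reindex]). Conversely, the value [q n j] is attained: the vector
supported at [j] and normalised in the [k]-th seminorm is mapped by [T^n] to a
vector supported at [s^n j] with [l]-th seminorm exactly [q n j]
([seminorm_supp]). Hence a lower bound on [||T^n x||_l] over the unit sphere is
the same thing as a lower bound on all the quotients, which is the equivalence
([injective_shift_expansive]). *)

(* Not the position of an item in a list. *)
Local Notation index := Defs.index.

Section sequences_supported_at_a_point.
Context (R : realType) (F : scalar_field) (J : index_set).
Variables (p : exponent R) (A : kothe_matrix R J).
Local Notation K := (scalars R F).
Implicit Types (x : index J -> K^o) (j : index J).

Lemma kothe_term_off x k j i : (forall i, i != j -> x i = 0) -> i != j ->
  kothe_term A x k i = 0.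
Proof. by move=> xj ij; rewrite /kothe_term xj// modulus0 mulr0. Qed.

Lemma psum_supp x k j : p != 0 :> R -> (forall i, i != j -> x i = 0) ->
  (\esum_(i in [set: index J]) (kothe_term A x k i `^ p)%:E)%E =
  (kothe_term A x k j `^ p)%:E.
Proof.
move=> p0 xj; rewrite -[RHS](esum_set1 (a := fun i => (kothe_term A x k i `^ p)%:E)).
  rewrite [RHS]esum_mkcond; apply: eq_esum => i _.
  have [->|ij] := eqVneq i j; first by rewrite mem_set.
  rewrite memNset; last exact/eqP.
  by rewrite (kothe_term_off _ xj)// powR0.
by rewrite lee_fin powR_ge0.
Qed.

Lemma in_kothe_supp x j : (forall i, i != j -> x i = 0) -> in_kothe p A x.
Proof.
move=> xj k; case: ifPn => p0; last by rewrite (psum_supp _ p0 xj) ltry.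
apply: cvg_near_cst; exists (index_abs j).+1 => // i /= ji.
rewrite (kothe_term_off _ xj)//.
by apply: contraTneq ji => ->; rewrite ltnn.
Qed.

Lemma kothe_seminorm_supp x k j : (forall i, i != j -> x i = 0) ->
  kothe_seminorm p A k x = kothe_term A x k j.
Proof.
move=> xj; have xA := in_kothe_supp xj.
have [p0|p0] := boolP (p == 0 :> R); last first.
  rewrite unlock (negbTE p0) (psum_supp _ p0 xj)/= -powRrM divff//.
  by rewrite powRr1// kothe_term_ge0.
apply/eqP; rewrite eq_le kothe_term_le// andbT.
apply: kothe_seminorm_le; first exact: kothe_term_ge0.
  move=> _ i; have [->//|ij] := eqVneq i j.
  by rewrite (kothe_term_off _ xj)// kothe_term_ge0.
by rewrite p0.
Qed.

End sequences_supported_at_a_point.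

(** The vectors that probe a single coordinate can be normalised in any seminorm
not vanishing there, for every nonnegative real is the modulus of a scalar. *)
Lemma modulus_surj (R : realType) (F : scalar_field) (r : R) : 0 <= r ->
  exists c : scalars R F, modulus c = r.
Proof.
case: F => r0 /=; first by exists r; rewrite ger0_norm.
by exists (r%:C)%C; rewrite /= expr0n addr0 sqrtr_sqr ger0_norm.
Qed.

Section comparison_of_seminorms.
Context (R : realType) (F : scalar_field) (J : index_set).
Variables (p : exponent R) (A : kothe_matrix R J).
Implicit Types x y : kothe F p A.

Lemma seminorm_supp x k j : (forall i, i != j -> kothe_val x i = 0) ->
  seminorm F p A k x = A j k * modulus (kothe_val x j).
Proof. exact: kothe_seminorm_supp. Qed.

(** The terms of [x] are dominated by those of [M^-1 y] along an injection;
forgetting the indices outside its range only decreases a supremum or a sum of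
nonnegative terms. *)
Lemma le_seminorm_reindex (g : index J -> index J) (M : R) x y k l :
  injective g -> 0 < M ->
  (forall j, M * kothe_term A (kothe_val x) k j <=
             kothe_term A (kothe_val y) l (g j)) ->
  M * seminorm F p A k x <= seminorm F p A l y.
Proof.
move=> g_inj M0 xy; have yA := kothe_valW y.
have S0 := seminorm_ge0 l y.
have {}xy j : kothe_term A (kothe_val x) k j <=
    M^-1 * kothe_term A (kothe_val y) l (g j) by rewrite ler_pdivlMl.
rewrite -ler_pdivlMl//; apply: kothe_seminorm_le.
- by rewrite mulr_ge0// invr_ge0 ltW.
- move=> p0 j; rewrite (le_trans (xy j))// ler_pM2l ?invr_gt0//.
  exact: kothe_term_le.
move=> p0; have Mp0 : 0 <= M^-1 by rewrite invr_ge0 ltW.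
pose b i := (kothe_term A (kothe_val y) l i `^ p)%:E.
have b0 i : (0 <= b i)%E by rewrite lee_fin powR_ge0.
apply: (@le_trans _ _ (\esum_(j in [set: index J]) ((M^-1 `^ p)%:E * b (g j)))%E).
  apply: le_esum => j _; rewrite -EFinM lee_fin -powRM ?kothe_term_ge0//.
  rewrite ge0_ler_powR ?nnegrE ?(ltW (exponent_gt0 p0)) ?kothe_term_ge0//.
  by rewrite mulr_ge0 ?kothe_term_ge0.
rewrite (le_trans (esumZl_le (powR_ge0 _ _) _))//.
rewrite powRM// EFinM lee_wpmul2l ?lee_fin ?powR_ge0//.
rewrite -psumE// -/(b _) -(esum_image [set: index J] g b); last first.
  by move=> i j _ _; exact: g_inj.
rewrite esum_mkcond; apply: le_esum => i _.
by rewrite -/(b i); case: ifP.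
Qed.

End comparison_of_seminorms.

Section shift_along_an_injection.
Context (R : realType) (F : scalar_field) (J : index_set).
Variables (p : exponent R) (A : kothe_matrix R J).
Local Notation K := (scalars R F).
Variables (T : kothe F p A -> kothe F p A) (s : index J -> index J).
Variables (w : index J -> K) (t : nat -> index J -> index J).
Hypothesis s_inj : injective s.
Hypothesis tE : forall n j, iter n s j = t n j.
Hypothesis T_on : forall x j, kothe_val (T x) (s j) = w j * kothe_val x j.
Hypothesis T_off : forall x i, (forall j, s j != i) -> kothe_val (T x) i = 0.

Lemma iter_shift_on n x j : kothe_val (iter n T x) (iter n s j) =
  \prod_(i < n) w (iter i s j) * kothe_val x j.
Proof.
elim: n => [|n IHn] /=; first by rewrite big_ord0 mul1r.
by rewrite T_on IHn big_ord_recr/= mulrA [w _ * _]mulrC.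
Qed.

Lemma iter_shift_off n x i : (forall j, iter n s j != i) ->
  kothe_val (iter n T x) i = 0.
Proof.
elim: n i => [|n IHn] i /= ni; first by have := ni i; rewrite eqxx.
have [[j ji]|sNi] := pselect (exists j, s j = i); last first.
  by apply: T_off => j; apply/eqP => ji; apply: sNi; exists j.
rewrite -ji T_on IHn ?mulr0// => j'.
by apply: contra_neq (ni j') => ->.
Qed.

(** The sequences supported at a point test the quotients one at a time; for the
converse, a lower bound common to all the quotients is a termwise one. *)
Lemma injective_shift_expansive :
  uniformly_positively_expansive (seminorm F p A) T <->
  forall k : nat, exists l : nat,
    ereal_inf [set (A (t n j) l * modulus (\prod_(i < n) w (t i j))
                    / A j k)%:E | j in [set j | A j k != 0]]
      @[n --> \oo] --> +oo%E.
Proof.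
have -> : t = fun n j => iter n s j.
  by apply/funext => n; apply/funext => j; rewrite tE.
split=> + k => /(_ k)[l lP]; exists l.
- apply/cvgeyPge => M; have := lP M; apply: filterS => n nP.
  apply/ereal_infP => _ [j /= jk <-]; rewrite lee_fin.
  have Ajk0 : 0 <= (A j k)^-1 by rewrite invr_ge0 kothe_coef_ge0.
  have [c cE] := modulus_surj F Ajk0.
  pose e : index J -> K^o := fun i => if i == j then c else 0.
  have e_off i : i != j -> e i = 0 by rewrite /e => /negbTE->.
  have eA : e \in kothe_mem p A by apply/asboolP; exact: in_kothe_supp e_off.
  pose x := Kothe eA.
  have xk : seminorm F p A k x = 1.
    by rewrite (seminorm_supp (x := x) _ e_off) /= /e eqxx cE divff.
  rewrite (le_trans (nP x xk))// (@seminorm_supp _ _ _ _ _ _ _ (iter n s j)).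
    by rewrite iter_shift_on/= /e eqxx modulusM cE mulrA.
  move=> i ij; have [[j' j'i]|sNi] := pselect (exists j', iter n s j' = i).
    rewrite -j'i iter_shift_on/= e_off ?mulr0//.
    by apply: contra_neq ij => <-; rewrite j'i.
  by apply: iter_shift_off => j'; apply/eqP => j'i; apply: sNi; exists j'.
- move=> M.
  (* The comparison of seminorms divides by the bound, hence a positive one. *)
  pose M1 := Num.max M 1.
  have M10 : 0 < M1 by rewrite lt_max ltr01 orbT.
  move/cvgeyPge : lP => /(_ M1); apply: filterS => n /ereal_infP nP x xk.
  apply: (@le_trans _ _ M1); first by rewrite le_max lexx.
  rewrite -[M1]mulr1 -xk; apply: (@le_seminorm_reindex _ _ _ _ _ (iter n s)) => //.
    by elim: (n) => // m IHm i j /= /s_inj /IHm.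
  move=> j; rewrite /kothe_term iter_shift_on modulusM !mulrA.
  rewrite ler_wpM2r ?modulus_ge0//.
  have [->|jk] := eqVneq (A j k) 0.
    by rewrite mulr0 mulr_ge0 ?kothe_coef_ge0 ?modulus_ge0.
  rewrite -ler_pdivlMr; last by rewrite lt_def jk kothe_coef_ge0.
  by rewrite -lee_fin; apply: nP; exists j.
Qed.

End shift_along_an_injection.

Lemma iter_addz1 n (j : int) : iter n (fun i => i + 1) j = j + n%:Z.
Proof. by elim: n => [|n /= ->]; rewrite ?addr0// -addrA -PoszD addn1. Qed.

Theorem mainTheorem6 (R : realType) (F : scalar_field) (p : exponent R) :
  (forall (A : kothe_matrix R Integers) (w : int -> scalars R F)
     (T : kothe F p A -> kothe F p A),
     (forall j, w j != 0) ->
     is_operator T ->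
     (forall x, kothe_val (T x) = bilateral_forward_shift w (kothe_val x)) ->
     (uniformly_positively_expansive (seminorm F p A) T <->
      forall k : nat, exists l : nat,
        ereal_inf [set (A (j + n%:Z) l * modulus (\prod_(i < n) w (j + i%:Z))
                        / A j k)%:E | j in [set j : int | A j k != 0]]
          @[n --> \oo] --> +oo%E))
  /\
  (forall (A : kothe_matrix R Naturals) (w : nat -> scalars R F)
     (T : kothe F p A -> kothe F p A),
     (forall j, w j != 0) ->
     is_operator T ->
     (forall x, kothe_val (T x) = unilateral_forward_shift w (kothe_val x)) ->
     (uniformly_positively_expansive (seminorm F p A) T <->
      forall k : nat, exists l : nat,
        ereal_inf [set (A (j + n)%N l * modulus (\prod_(i < n) w (j + i)%N)
                        / A j k)%:E | j in [set j : nat | A j k != 0]]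
          @[n --> \oo] --> +oo%E)).
Proof.
split=> A w T _ _ TE.
- have s_inj : injective (fun j : index Integers => (j : int) + 1 : index Integers).
    exact: addIr.
  have T_on x (j : index Integers) :
      kothe_val (T x) ((j : int) + 1) = w j * kothe_val x j.
    by rewrite TE /bilateral_forward_shift addrK.
  have T_off x (i : index Integers) :
      (forall j : index Integers, ((j : int) + 1 : index Integers) != i) ->
      kothe_val (T x) i = 0.
    by move=> /(_ ((i : int) - 1)); rewrite subrK eqxx.
  exact: (injective_shift_expansive s_inj iter_addz1 T_on T_off).
- have s_inj : @injective (index Naturals) (index Naturals) succn by exact: succn_inj.
  have T_on x (j : index Naturals) :
      kothe_val (T x) (succn j) = w j * kothe_val x j by rewrite TE.
  have T_off x (i : index Naturals) :
      (forall j : index Naturals, (succn j : index Naturals) != i) ->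
      kothe_val (T x) i = 0.
    by rewrite TE; case: i => //= i /(_ i); rewrite eqxx.
  exact: (injective_shift_expansive s_inj (fun n j => iter_succn j n) T_on T_off).
Qed.
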